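(* For integers $s\geq k\geq 0$ let $F_{k,s}(x)=\sum_{n\geq s+1}\frac{p_{n;\leq n-k}^{n-s}}{(n-1)!}x^n$ and for $s\ge 0$ let $T_s(x)=\sum_{n\geq s+1}\frac{p_n^{n-s}}{(n-1)!}x^n$. Then $F_{0,s}(x)=T_s(x)$ and for all $1\leq k\leq s$ $$F_{k,s}(x)=T_{s}(x)-\sum_{i=1}^k\frac{(k-i+1)(k+1)^{i-1}}{i!}x^iF_{k-i,s-i}(x).$$ Furthermore, $$F_{k,s}(x)=\sum_{i=0}^{k}\frac{(-1)^i(k+1-i)^i}{i!}x^iT_{s-i}(x).$$
   Context: There are $n$ parking spaces in a line numbered $1,\dots,n$; $n$ cars arrive in order, car $j$ has preference $a_j\in[n]$ and parks in the first unoccupied space numbered $\geq a_j$, if any; $(a_1,\dots,a_n)$ is a parking function if all cars park. $p_n^l$ is the number of parking functions of length $n$ with $a_1=l$, and $p_{n;\leq t}^l$ is the number of parking functions of length $n$ with $a_1=l$ and all $a_j\leq t$. *)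

(* Defs.v *)
From mathcomp Require Import all_boot all_order all_algebra.

Set Implicit Arguments.
Unset Strict Implicit.
Unset Printing Implicit Defensive.

(* Spaces and preferences are elements of 'I_n, with i : 'I_n standing for the
   number i + 1 of [n].  Only [label] below crosses between the numberings. *)

Section Parking.
Variable n : nat.

Definition label (i : 'I_n) : nat := i.+1.

Definition available (occ : {set 'I_n}) (a i : 'I_n) : bool :=
  (a <= i) && (i \notin occ).

Definition first_available (occ : {set 'I_n}) (a : 'I_n) : option 'I_n :=
  [pick i | available occ a i & [forall j, available occ a j ==> (i <= j)]].

Fixpoint all_park (occ : {set 'I_n}) (s : seq 'I_n) : bool :=
  if s is a :: s' then
    if first_available occ a is Some i then all_park (i |: occ) s' else false
  else true.

Definition parking_function (a : n.-tuple 'I_n) : bool := all_park set0 a.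

(* [ohead] makes "a_1 = l" false when n = 0. *)
Definition first_pref_is (l : nat) (a : n.-tuple 'I_n) : bool :=
  ohead (map label a) == Some l.

Definition prefs_le (t : nat) (a : n.-tuple 'I_n) : bool :=
  all (fun i => label i <= t) a.

Definition pf_count (l : nat) : nat :=
  #|[set a : n.-tuple 'I_n | parking_function a && first_pref_is l a]|.

Definition pf_count_le (t l : nat) : nat :=
  #|[set a : n.-tuple 'I_n |
      [&& parking_function a, first_pref_is l a & prefs_le t a]]|.

End Parking.

Local Open Scope ring_scope.

(* Formal power series over the rationals as coefficient sequences; two series
   are equal when all their coefficients are, i.e. up to =1. *)
Definition fps := nat -> rat.

Declare Scope fps_scope.
Delimit Scope fps_scope with fps.
Bind Scope fps_scope with fps.

Definition fps_zero : fps := fun _ => 0.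
Definition fps_add (f g : fps) : fps := fun m => f m + g m.
Definition fps_sub (f g : fps) : fps := fun m => f m - g m.
Definition fps_mul (f g : fps) : fps :=
  fun m => \sum_(j < m.+1) f j * g (m - j)%N.

(* c x^i *)
Definition fps_monom (c : rat) (i : nat) : fps :=
  fun m => if m == i then c else 0.

Notation "f - g" := (fps_sub f g) : fps_scope.
Notation "f * g" := (fps_mul f g) : fps_scope.
Notation "\sum_ ( m <= i < n ) F" :=
  (\big[fps_add/fps_zero]_(m <= i < n) F%fps) : fps_scope.

Definition F_series (k s : nat) : fps := fun n =>
  if (s.+1 <= n)%N then (pf_count_le n (n - k) (n - s))%:R / ((n - 1)`!)%:R
  else 0.

Definition T_series (s : nat) : fps := fun n =>
  if (s.+1 <= n)%N then (pf_count n (n - s))%:R / ((n - 1)`!)%:R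
  else 0.

(* Main.v *)
(* Cars fill all [n] spaces iff for every [j] at least [j] cars prefer one of
   the first [j] spaces.  Hence deleting the cars that prefer the last allowed
   space [t + 1] turns a parking function of length [n] with preferences at most
   [t + 1] into one of length [n - m] with preferences at most [t], whatever the
   [m] deleted positions are; the first car survives as [l <= t].  For fixed [l]
   this says
     [F_k = \sum_(0 <= m <= k + 1) x^m / m! F_(k + 1 - m)],
   i.e. [\sum_k F_k y^k = T / (exp (x y) - y)], whose expansion in [y] is the
   closed formula.  The other recursion inverts that formula, by the binomial
   theorem. *)

Require Import Defs.
From mathcomp Require Import all_boot all_order all_algebra.
From mathcomp Require Import zify ring.

Set Implicit Arguments.
Unset Strict Implicit.
Unset Printing Implicit Defensive.

(** * Hall's condition for parking *)

Definition free_from (n : nat) (occ : {set 'I_n}) (j : nat) : nat :=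
  #|[set i : 'I_n | (j <= i) && (i \notin occ)]|.

Lemma free_from_setU1 (n : nat) (occ : {set 'I_n}) (i : 'I_n) (j : nat) :
  i \notin occ -> free_from occ j = (j <= i) + free_from (i |: occ) j.
Proof.
move=> iNocc; rewrite /free_from (cardsD1 i) inE iNocc andbT; congr (_ + _).
apply: eq_card => x; rewrite !inE negb_or.
by case: (x == i); rewrite /= ?andbF.
Qed.

(* Hall's condition on final segments of spaces decides whether all cars park. *)
Lemma all_parkP (n : nat) (occ : {set 'I_n}) (s : seq 'I_n) :
  reflect (forall j, count (fun x : 'I_n => j <= x) s <= free_from occ j)
          (all_park occ s).
Proof.
elim: s occ => [|a s IHs] occ /=; first by apply: ReflectT.
rewrite /first_available; case: pickP => [i /andP[/andP[ai iNocc] /forallP imin]|none].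
  apply: (iffP (IHs _)) => H j; have := H j; rewrite (free_from_setU1 j iNocc).
    by case: (leqP j a) => [ja|]; lia.
  case: (leqP j a) => [ja|aj]; first lia.
  case: (leqP j i) => [ji _|]; last lia.
  (* Here [a < j <= i]. No space in [[a, i)] is free, so the spaces from [a] on that stay free all
     lie beyond [j], and the condition at [a] yields the one at [j]. *)
  have /= := H a; rewrite leqnn (free_from_setU1 a iNocc) ai leq_add2l => Ha.
  apply: leq_trans (leq_trans _ Ha) _; first by apply: sub_count => x /=; lia.
  apply: subset_leq_card; apply/subsetP => x; rewrite !inE => /andP[ax].
  rewrite negb_or => /andP[-> xNocc]; rewrite xNocc !andbT.
  by apply: leq_trans ji _; apply: (implyP (imin x)); rewrite /available ax.
(* The car preferring [a] already violates the condition at [a]: a free space from [a] on would give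
   a least one, which [pick] would have found. *)
apply: ReflectF => /(_ a); rewrite leqnn; apply/negP; rewrite -ltnNge.
suff -> : free_from occ a = 0 by [].
apply: eq_card0 => x; rewrite inE; apply/negP => ax.
case: (@arg_minnP _ x (available occ a) (fun y => y) ax) => y ay ymin.
have := none y; rewrite ay /= => /negP; apply.
by apply/forallP => z; apply/implyP => /ymin.
Qed.

(** The bound [t] is independent of the length, so that one predicate serves words of every length
    under a cap on preferences. *)
Definition dense_below (t : nat) (s : seq nat) : bool :=
  all (fun j => j <= count (fun x => x < j) s) (iota 0 t.+1).

Lemma dense_belowP (t : nat) (s : seq nat) :
  reflect (forall j, j <= t -> j <= count (fun x => x < j) s) (dense_below t s).
Proof.
apply: (iffP allP) => H j; first by move=> jt; apply: H; rewrite mem_iota; lia.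
by rewrite mem_iota => jt; apply: H; lia.
Qed.

Lemma dense_below_perm (t : nat) (s1 s2 : seq nat) :
  perm_eq s1 s2 -> dense_below t s1 = dense_below t s2.
Proof.
by move=> /permP s12; apply: eq_all => j; rewrite s12.
Qed.

(** For [t < j <= n] all [n] entries are below [j], so these conditions are automatic. *)
Lemma dense_below_size (t n : nat) (s : seq nat) :
  all (fun x => x < t) s -> size s = n -> t <= n ->
  dense_below n s = dense_below t s.
Proof.
move=> st sn tn; apply/dense_belowP/dense_belowP => H j jt; first by apply: H; lia.
case: (leqP j t) => [/H //|tj].
suff /eqP -> : count (fun x => x < j) s == size s by rewrite sn.
rewrite -all_count; apply: sub_all st => x /=; lia.
Qed.

Lemma free_from_set0 (n j : nat) : free_from (@set0 'I_n) j = n - j.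
Proof.
rewrite /free_from -sum1_card.
under eq_bigl do rewrite inE in_set0 andbT.
rewrite -(big_mkord (fun i => j <= i) (fun=> 1)).
case: (leqP j n) => jn; last first.
  by rewrite big_nat_cond big1; lia.
rewrite (big_cat_nat (n := j)) //= big_nat_cond big1 ?add0n; last by move=> i; lia.
rewrite big_nat_cond (eq_bigl (fun i => j <= i < n)); last by move=> i; lia.
by rewrite -big_nat sum_nat_const_nat muln1.
Qed.

(** In the empty lot [n - j] spaces are free from [j] on; complementing turns final segments into
    initial ones. *)
Lemma parking_functionE (n : nat) (a : n.-tuple 'I_n) :
  parking_function a = dense_below n (map val a).
Proof.
have cnt j : count (fun x : 'I_n => j <= x) a + count (fun x => x < j) (map val a) = n.
  rewrite -[RHS](size_tuple a) -(count_predC (fun x : 'I_n => j <= x)) count_map.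
  by congr (_ + _); apply: eq_count => x /=; rewrite ltnNge.
rewrite /parking_function; apply/all_parkP/dense_belowP => H j.
  by move=> jn; have := H j; have := cnt j; rewrite free_from_set0; lia.
rewrite free_from_set0; case: (leqP j n) => [/H|jn]; first by have := cnt j; lia.
rewrite (eq_count (a2 := pred0)) ?count_pred0 // => x /=.
by have := ltn_ord x; lia.
Qed.

(** * Counting words by the positions of the largest letter *)

(* The number of words [w] of length [N] in letters [< t] for which
   [g (w ++ s)] holds. *)
Fixpoint word_count (N t : nat) (g : seq nat -> bool) (s : seq nat) : nat :=
  if N is N'.+1 then \sum_(v < t) word_count N' t g (val v :: s) else g s.

Lemma eq_word_count (N t : nat) (g h : seq nat -> bool) (s s' : seq nat) :
  (forall w, size w = N -> all (fun x => x < t) w -> g (w ++ s) = h (w ++ s')) ->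
  word_count N t g s = word_count N t h s'.
Proof.
elim: N s s' => [|N IH] s s' gh /=; first by have /= -> := gh [::].
apply: eq_bigr => v _; apply: IH => w sw aw.
rewrite -!cat_rcons; apply: gh; first by rewrite size_rcons sw.
by rewrite all_rcons aw ltn_ord.
Qed.

Lemma word_count_perm (N t : nat) (g : seq nat -> bool) (s s' : seq nat) :
  (forall s1 s2, perm_eq s1 s2 -> g s1 = g s2) ->
  perm_eq s s' -> word_count N t g s = word_count N t g s'.
Proof.
by move=> gP ss'; apply: eq_word_count => w _ _; apply: gP; rewrite perm_cat2l.
Qed.

(** Sort the words by the set of [m] positions holding the letter [t]; as [g] ignores order, those
    letters can move to the suffix. The induction on [N] is Pascal's rule. *)
Lemma word_countS (N t : nat) (g : seq nat -> bool) (s : seq nat) :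
  (forall s1 s2, perm_eq s1 s2 -> g s1 = g s2) ->
  word_count N t.+1 g s =
  \sum_(m < N.+1) 'C(N, m) * word_count (N - m) t g (nseq m t ++ s).
Proof.
move=> gP; elim: N s => [|N IH] s; first by rewrite big_ord1 /= mul1n.
pose B m := word_count (N.+1 - m) t g (nseq m t ++ s).
have B0 : \sum_(v < t) word_count N t.+1 g (val v :: s) = \sum_(m < N.+1) 'C(N, m) * B m.
  under eq_bigr do rewrite IH.
  rewrite exchange_big; apply: eq_bigr => m _ /=; rewrite -big_distrr /=.
  rewrite /B subSn -1?ltnS //=; congr (_ * _); apply: eq_bigr => v _.
  by apply: word_count_perm => //; rewrite -cat1s perm_catCA.
have B1 : word_count N t.+1 g (t :: s) = \sum_(m < N.+1) 'C(N, m) * B m.+1.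
  rewrite IH; apply: eq_bigr => m _; rewrite /B subSS; congr (_ * _).
  by apply: word_count_perm => //; rewrite -cat1s perm_catCA.
rewrite /= big_ord_recr /= B0 B1 [RHS]big_ord_recl /= -/(B 0).
under [X in _ = _ + X]eq_bigr do rewrite /bump /= add1n binS mulnDl -/(B _.+1).
rewrite big_split /= addnA; congr (_ + _).
rewrite big_ord_recl /= [in RHS]big_ord_recr /= (bin_small (leqnn N.+1)) mul0n addn0.
by rewrite !bin0.
Qed.

(** The conditions at [j <= t] do not see the letters [t], and the one at [t + 1] is automatic: all
    [N + 1 >= t + 1] entries lie below it. *)
Lemma word_count_dense_rec (N t l : nat) : t <= N -> l <= t ->
  word_count N t.+1 (dense_below t.+1) [:: l] =
  \sum_(m < N.+1) 'C(N, m) * word_count (N - m) t (dense_below t) [:: l].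
Proof.
move=> tN lt; rewrite word_countS; last exact: dense_below_perm.
apply: eq_bigr => m _; congr (_ * _); apply: eq_word_count => w sw aw.
apply/dense_belowP/dense_belowP => H j jt.
  have := H j; rewrite !count_cat count_nseq /=; lia.
case: (ltngtP j t.+1) jt => // [jt _|-> _].
  by have := H j; rewrite !count_cat count_nseq /=; lia.
rewrite !count_cat count_nseq /= ltnSn ltnS lt.
suff /eqP -> : count (fun x => x < t.+1) w == size w by have := ltn_ord m; lia.
by rewrite -all_count; apply: sub_all aw => x /=; lia.
Qed.

Lemma word_count_dense_small (N t l : nat) :
  N.+1 < t -> word_count N t (dense_below t) [:: l] = 0.
Proof.
move=> Nt; transitivity (word_count N t (fun=> false) [::]); last first.
  by move: [::]; elim: (N) => [|M IH] s //=; apply: big1 => v _; apply: IH.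
apply: eq_word_count => w sw _; apply/negP => /dense_belowP/(_ _ (leqnn t)).
by have := count_size (fun x => x < t) (w ++ [:: l]); rewrite size_cat /=; lia.
Qed.

(** * From parking functions to words *)

Lemma sum_tuple_cons (T : finType) (N : nat) (F : N.+1.-tuple T -> nat) :
  \sum_a F a = \sum_v \sum_(a : N.-tuple T) F [tuple of v :: a].
Proof.
rewrite pair_big /= (reindex (fun p : T * N.-tuple T => [tuple of p.1 :: p.2])) //=.
exists (fun a => (thead a, [tuple of behead a])) => [[v a] _|a _] /=.
  by congr (_, _); apply: val_inj.
by rewrite [RHS]tuple_eta; apply: val_inj.
Qed.

Lemma sum_tuple_word_count (n N t : nat) (g : seq nat -> bool) (s : seq nat) :
  (forall s1 s2, perm_eq s1 s2 -> g s1 = g s2) -> t <= n ->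
  \sum_(a : N.-tuple 'I_n) (all (fun i : 'I_n => i < t) a && g (map val a ++ s)) =
  word_count N t g s.
Proof.
move=> gP tn; elim: N s => [|N IH] s.
  rewrite (eq_bigr (fun=> g s : nat)) => [|a _]; last by rewrite tuple0.
  by rewrite sum_nat_const card_tuple mul1n.
rewrite sum_tuple_cons /= (big_ord_widen n (fun v => word_count N t g (v :: s))) //.
rewrite [RHS]big_mkcond /=; apply: eq_bigr => v _; case: ifP => vt /=; last exact: big1.
rewrite -IH; apply: eq_bigr => a _; congr (nat_of_bool (_ && _)).
by apply: gP; rewrite -[val v :: s]cat1s -[_ :: _]cat1s perm_catCA.
Qed.

(** The prescribed first preference becomes the suffix [[:: l]], since density ignores order; the
    other [n - 1] preferences are free letters. *)
Lemma pf_count_leE (n t l : nat) : l < t -> t <= n ->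
  pf_count_le n t l.+1 = word_count n.-1 t (dense_below t) [:: l].
Proof.
case: n => [|N] lt tn; first lia.
have lN : l < N.+1 by lia.
rewrite -(@sum_tuple_word_count N.+1) //; last exact: dense_below_perm.
rewrite /pf_count_le -sum1_card big_mkcond sum_tuple_cons (bigD1 (Ordinal lN)) //=.
rewrite [X in _ + X]big1 ?addn0 => [|v vl]; last first.
  apply: big1 => a _; rewrite inE /first_pref_is /= (inj_eq Some_inj) /label.
  suff -> : (v.+1 == l.+1) = false by rewrite andbF.
  by rewrite eqSS; apply: negPf vl.
apply: eq_bigr => a _; rewrite inE /first_pref_is eqxx /= parking_functionE /prefs_le /=.
rewrite /label /= lt /=; case: allP => aP /=; last by rewrite andbF.
rewrite (@dense_below_size t) ?andbT //=.
- have lP : perm_eq (l :: map val a) (map val a ++ [:: l]).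
    by rewrite cats1 perm_sym perm_rcons.
  by rewrite (dense_below_perm t lP); case: ifP.
- by rewrite lt; apply/allP => x /mapP[y ya ->]; apply: aP.
- by rewrite size_map size_tuple.
Qed.

Lemma pf_countE (n l : nat) : pf_count n l = pf_count_le n n l.
Proof.
apply: eq_card => a; rewrite !inE; suff -> : prefs_le n a by rewrite andbT.
by apply/allP => i _; apply: ltn_ord.
Qed.

Local Open Scope ring_scope.
Import GRing.Theory Num.Theory.

(** * Solving the recurrence over the rationals *)

Lemma sum_triangle (R : nmodType) (K : nat) (G : nat -> nat -> R) :
  \sum_(m < K) \sum_(i < K - m) G m i = \sum_(r < K) \sum_(m < r.+1) G m (r - m)%N.
Proof.
elim: K => [|K IH]; first by rewrite !big_ord0.
rewrite [RHS]big_ord_recr /= -IH [LHS]big_ord_recr /= subSnn big_ord1.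
rewrite [\sum_(m < K.+1) G m (K - m)%N]big_ord_recr /= subnn addrA; congr (_ + _).
rewrite -big_split; apply: eq_bigr => m _ /=.
by rewrite subSn ?big_ord_recr // ltnW.
Qed.

Lemma exprDn_fact (x y : rat) (r : nat) :
  \sum_(m < r.+1) (x ^+ m / m`!%:R) * (y ^+ (r - m) / (r - m)`!%:R) =
  (x + y) ^+ r / r`!%:R.
Proof.
rewrite addrC exprDn mulr_suml; apply: eq_bigr => m _.
have mr : (m <= r)%N by rewrite -ltnS.
have nz k : k`!%:R != 0 :> rat by rewrite pnatr_eq0 -lt0n fact_gt0.
rewrite -(bin_fact mr) !natrM -mulr_natr.
have b0 : 'C(r, m)%:R != 0 :> rat by rewrite pnatr_eq0 -lt0n bin_gt0.
by field; rewrite b0 !nz.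
Qed.

(* With [K = k + 1] this is [(K + y)^r - r (K + y)^(r-1)] at [y = r - K],
   expanded by the binomial theorem. *)
Lemma abel_sum_eq0 (k r : nat) : (0 < r)%N ->
  (- (k.+1%:R - r%:R)) ^+ r / r`!%:R
  + \sum_(1 <= m < r.+1) (((k.+1%:R - m%:R) * k.+1%:R ^+ m.-1) / m`!%:R)
       * ((- (k.+1%:R - r%:R)) ^+ (r - m) / (r - m)`!%:R) = 0 :> rat.
Proof.
case: r => // r _; set y := - _.
have fS m : m.+1`!%:R = m.+1%:R * m`!%:R :> rat by rewrite factS natrM.
have nzf m : m`!%:R != 0 :> rat by rewrite pnatr_eq0 -lt0n fact_gt0.
have nzS m : m.+1%:R != 0 :> rat by rewrite pnatr_eq0.
rewrite big_add1 big_mkord /=.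
(* With [K = k + 1], the identity [(K - m) K^(m-1) / m! = K^m / m! - K^(m-1) / (m-1)!] splits the
   sum into two binomial ones. *)
under eq_bigr => m _.
  rewrite subSS (_ : _ * _ = (k.+1%:R ^+ m.+1 / m.+1`!%:R) * (y ^+ (r - m) / (r - m)`!%:R)
     - (k.+1%:R ^+ m / m`!%:R) * (y ^+ (r - m) / (r - m)`!%:R)); last first.
    by rewrite fS exprS; field; rewrite nat1r !nzf nzS.
  over.
rewrite sumrB exprDn_fact addrA.
have := exprDn_fact k.+1%:R y r.+1; rewrite big_ord_recl /= expr0 fact0 divr1 mul1r subn0 => E.
under [X in _ + X - _]eq_bigr do rewrite -add1n.
rewrite {}E.
have -> : k.+1%:R + y = r.+1%:R by rewrite /y; ring.
by rewrite fS exprS -mulrA; field; rewrite nat1r nzf nzS.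
Qed.

(** The term [m = 0] of the recurrence is [U n k.+1], so strong induction on [k] applies after
    solving for it; then coefficients of [U (n - r) 0] are compared. *)
Lemma parking_recurrence_solution (l : nat) (U : nat -> nat -> rat) :
  (forall n k, (k.+1 + l <= n)%N ->
     U n k = \sum_(m < k.+2) (m`!%:R)^-1 * U (n - m)%N (k.+1 - m)%N) ->
  forall n k, (k + l <= n)%N ->
  U n k = \sum_(i < k.+1) (- (k.+1%:R - i%:R)) ^+ i / i`!%:R * U (n - i)%N 0%N.
Proof.
move=> recU n k; elim/ltn_ind: k n => -[|k] IH n kn.
  by rewrite big_ord1 expr0 divr1 mul1r subn0.
have := recU _ _ kn; rewrite big_ord_recl fact0 invr1 mul1r !subn0.
move=> /esym/(canRL (addrK _)) ->.
rewrite (IH k) //; last lia.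
pose A m i : rat := (m`!%:R)^-1 * ((- (k.+2%:R - m%:R - i%:R)) ^+ i / i`!%:R).
have -> : \sum_(i < k.+1) (bump 0 i)`!%:R^-1 * U (n - bump 0 i)%N (k.+1 - bump 0 i)%N
  = \sum_(m < k.+1) \sum_(i < k.+1 - m) A m.+1 i * U (n - (m.+1 + i))%N 0%N.
  apply: eq_bigr => m _; have mk := ltn_ord m; rewrite /bump /= add1n subSS IH; [|lia..].
  rewrite mulr_sumr -subSn; last lia.
  apply: eq_bigr => i _; rewrite /A subnDA !mulrA; congr (_ * _ * _ * _).
  congr ((- (_ - _)) ^+ _); rewrite subSn; last lia.
  rewrite -natr1 natrB; last lia.
  by rewrite -!natr1; ring.
rewrite (sum_triangle _ (fun m i => A m.+1 i * U (n - (m.+1 + i))%N 0%N)) /=.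
rewrite [RHS]big_ord_recl [X in X - _]big_ord_recl /= !expr0 fact0 !divr1 !mul1r subn0 -addrA.
congr (_ + _).
under [X in _ - X]eq_bigr => r _.
  rewrite (eq_bigr (fun m : 'I_r.+1 => A m.+1 (r - m)%N * U (n - r.+1)%N 0%N)) => [|m _].
    rewrite -mulr_suml; over.
  by congr (_ * U (n - _)%N _); have := ltn_ord m; lia.
(* The added term [i = k + 1] vanishes, its base being 0. *)
have -> : \sum_(i < k) (- (k.+1%:R - (bump 0 i)%:R)) ^+ bump 0 i / (bump 0 i)`!%:R
    * U (n - bump 0 i)%N 0%N
  = \sum_(i < k.+1) (- (k.+1%:R - i.+1%:R)) ^+ i.+1 / (i.+1)`!%:R * U (n - i.+1)%N 0%N.
  by rewrite [RHS]big_ord_recr /= subrr oppr0 expr0n !mul0r addr0.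
rewrite -sumrB; apply: eq_bigr => r _; rewrite -mulrBl /bump /= add1n; congr (_ * _).
(* With [m + i] fixed, the base in [A m i] does not depend on [m], so the sum over [m] is a binomial
   expansion with first summand 1. *)
have := exprDn_fact 1 (- (k.+2%:R - r.+1%:R)) r.+1.
have -> : 1 + - (k.+2%:R - r.+1%:R) = - (k.+1%:R - r.+1%:R) :> rat by rewrite -!natr1; ring.
move=> <-; rewrite big_ord_recl /= expr0 fact0 divr1 mul1r subn0 -addrA.
rewrite [X in _ + X](_ : _ = 0) ?addr0 //; apply/eqP; rewrite subr_eq0; apply/eqP.
apply: eq_bigr => m _; rewrite /A /bump /= add1n subSS expr1n mul1r; congr (_ * _).
congr ((- _) ^+ _ / _); rewrite -(natr1 r) natrB; last by rewrite -ltnS.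
by rewrite -(natr1 m); ring.
Qed.

(** Substituting the closed formula for every [U] reduces the claim to [abel_sum_eq0], one instance
    for each [U (n - r) 0]. *)
Lemma parking_recurrence_inverse (l : nat) (U : nat -> nat -> rat) :
  (forall n k, (k.+1 + l <= n)%N ->
     U n k = \sum_(m < k.+2) (m`!%:R)^-1 * U (n - m)%N (k.+1 - m)%N) ->
  forall n k, (k + l <= n)%N ->
  U n k = U n 0%N - \sum_(1 <= i < k.+1)
    ((k.+1%:R - i%:R) * k.+1%:R ^+ i.-1) / i`!%:R * U (n - i)%N (k - i)%N.
Proof.
move=> recU n k kn; rewrite big_add1 big_mkord.
rewrite (parking_recurrence_solution recU) //=.
rewrite big_ord_recl expr0 fact0 divr1 mul1r subn0; congr (_ + _).
pose A m i : rat := ((k.+1%:R - m%:R) * k.+1%:R ^+ m.-1) / m`!%:R *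
  ((- (k.+1%:R - m%:R - i%:R)) ^+ i / i`!%:R).
have -> : \sum_(i < k) ((k.+1%:R - i.+1%:R) * k.+1%:R ^+ i) / i.+1`!%:R
    * U (n - i.+1)%N (k - i.+1)%N
  = \sum_(m < k) \sum_(i < k - m) A m.+1 i * U (n - (m.+1 + i))%N 0%N.
  apply: eq_bigr => m _; have mk := ltn_ord m; rewrite (parking_recurrence_solution recU); last lia.
  rewrite mulr_sumr subnSK //; apply: eq_bigr => i _; rewrite /A /= subnDA mulrA.
  congr (_ * ((- (_ - _)) ^+ _ / _) * _).
  by rewrite -natrB; [congr (_ %:R)|]; lia.
rewrite (sum_triangle _ (fun m i => A m.+1 i * U (n - (m.+1 + i))%N 0%N)) /= -sumrN.
apply: eq_bigr => r _; rewrite /bump /= add1n.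
rewrite (eq_bigr (fun m : 'I_r.+1 => A m.+1 (r - m)%N * U (n - r.+1)%N 0%N)) => [|m _]; last first.
  by congr (_ * U (n - _)%N _); have := ltn_ord m; lia.
rewrite -mulr_suml -mulNr; congr (_ * _); apply/eqP; rewrite -addr_eq0; apply/eqP.
rewrite -[RHS](@abel_sum_eq0 k r.+1) // big_add1 big_mkord; congr (_ + _).
apply: eq_bigr => m _; rewrite /A subSS; congr (_ * ((- _) ^+ _ / _)).
rewrite -(natr1 r) natrB; last by rewrite -ltnS.
by rewrite -(natr1 m); ring.
Qed.

(** * Coefficients of the series *)

Lemma fps_sumE (F : nat -> fps) (a b m : nat) :
  (\sum_(a <= i < b) F i)%fps m = \sum_(a <= i < b) F i m.
Proof. by apply: (big_morph (fun f : fps => f m)). Qed.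

Lemma fps_monom_mulE (c : rat) (i : nat) (f : fps) (m : nat) :
  (fps_monom c i * f)%fps m = if (i <= m)%N then c * f (m - i)%N else 0.
Proof.
rewrite /fps_mul /fps_monom; case: leqP => im.
  rewrite (bigD1 (Ordinal (im : (i < m.+1)%N))) //= eqxx big1 ?addr0 // => j ji.
  by have /negPf -> : (j : nat) != i := ji; rewrite mul0r.
by apply: big1 => j _; rewrite ifF ?mul0r //; have := ltn_ord j; lia.
Qed.

(* The coefficient of [x^n] in [F_(k, n - l - 1)]; preferences count from 0. *)
Definition parking_coef (l n k : nat) : rat :=
  (word_count n.-1 (n - k) (dense_below (n - k)) [:: l])%:R / (n.-1)`!%:R.

Lemma parking_coef_rec (l n k : nat) : (k.+1 + l.+1 <= n)%N ->
  parking_coef l n k =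
  \sum_(m < k.+2) (m`!%:R)^-1 * parking_coef l (n - m) (k.+1 - m).
Proof.
case: n => // n kn; rewrite /parking_coef (_ : (n.+1 - k)%N = (n - k).+1); last lia.
rewrite word_count_dense_rec; [|lia..].
rewrite -(big_mkord xpredT
  (fun m => 'C(n, m) * word_count (n - m) (n - k) (dense_below (n - k)) [:: l])%N).
rewrite (big_cat_nat (n := k.+2)) //=; last lia.
(* For [m > k + 1] fewer cars than allowed spaces remain, so the sum stops at [k + 1]. *)
rewrite [X in (_ + X)%N]big_nat [X in (_ + X)%N]big1 ?addn0 => [|m km]; last first.
  by rewrite word_count_dense_small ?muln0 //; lia.
rewrite big_mkord natr_sum mulr_suml; apply: eq_bigr => m _; have mk := ltn_ord m.
have -> : (n.+1 - m - (k.+1 - m) = n - k)%N by lia.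
have -> : ((n.+1 - m).-1 = n - m)%N by lia.
have mn : (m <= n)%N by lia.
have nz j : j`!%:R != 0 :> rat by rewrite pnatr_eq0 -lt0n fact_gt0.
have b0 : 'C(n, m)%:R != 0 :> rat by rewrite pnatr_eq0 -lt0n bin_gt0.
by rewrite -(bin_fact mn) !natrM; field; rewrite b0 !nz.
Qed.

Lemma F_seriesE (k s n : nat) : (k <= s)%N -> (s < n)%N ->
  F_series k s n = parking_coef (n - s).-1 n k.
Proof.
move=> ks sn; rewrite /F_series sn /parking_coef subn1.
by rewrite -{1}(@prednK (n - s)) ?pf_count_leE //; lia.
Qed.

Lemma T_seriesE (s : nat) : T_series s =1 F_series 0 s.
Proof. by move=> n; rewrite /T_series /F_series pf_countE subn0. Qed.

(** As [(n - i) - (s - i) = n - s], multiplying by [x^i] and lowering [s] by [i] keeps the first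
    preference fixed. *)
Lemma F_series_shiftE (k s i n : nat) : (i <= k <= s)%N -> (s < n)%N ->
  F_series (k - i) (s - i) (n - i)%N = parking_coef (n - s).-1 (n - i) (k - i).
Proof.
move=> iks sn; rewrite F_seriesE; [|lia..].
by congr parking_coef; lia.
Qed.

Theorem theorem3p10 :
  (forall s : nat, F_series 0 s =1 T_series s) /\
  (forall k s : nat, (1 <= k <= s)%N ->
     F_series k s =1
     (T_series s -
      \sum_(1 <= i < k.+1)
        fps_monom (((k - i + 1) * (k + 1) ^ (i - 1))%N%:R / (i`!)%:R)%R i
        * F_series (k - i) (s - i))%fps) /\
  (forall k s : nat, (k <= s)%N ->
     F_series k s =1
     (\sum_(0 <= i < k.+1)
        fps_monom ((-1) ^+ i * ((k + 1 - i) ^ i)%N%:R / (i`!)%:R)%R i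
        * T_series (s - i))%fps).
Proof.
split; first by move=> s n; rewrite T_seriesE.
split=> k s ks n; have {}ks : (k <= s)%N by lia.
- rewrite /fps_sub fps_sumE T_seriesE; case: (ltnP s n) => sn; last first.
    (* For [n <= s] both sides are 0, because [n - i <= s - i] in each product. *)
    rewrite /F_series ltnNge sn /= big_nat_cond big1 ?subr0 // => i ik.
    by rewrite fps_monom_mulE; case: (leqP i n) => // ni; rewrite ifF ?mulr0 //; lia.
  (* This choice of [l] equals [n - s], so the side condition [k + l <= n] amounts to [k <= s]. *)
  rewrite !F_seriesE // (parking_recurrence_inverse (l := (n - s).-1.+1)); last lia.
    congr (_ - _); apply: eq_big_nat => i ik; rewrite fps_monom_mulE ifT; last lia.
    rewrite F_series_shiftE //; last lia.
    by rewrite natrM natrX subn1 !addn1 -natrB ?subSn //; lia.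
  by move=> m j; apply: parking_coef_rec.
- rewrite fps_sumE; case: (ltnP s n) => sn; last first.
    rewrite /F_series ltnNge sn /= big_nat_cond big1 // => i ik.
    rewrite fps_monom_mulE /T_series.
    by case: (leqP i n) => // ni; rewrite ifF ?mulr0 //; lia.
  rewrite F_seriesE // (parking_recurrence_solution (l := (n - s).-1.+1)); last lia.
    rewrite big_mkord; apply: eq_bigr => i _; have ik := ltn_ord i.
    rewrite fps_monom_mulE ifT; last lia.
    rewrite T_seriesE -[0%N in RHS](subnn i) F_series_shiftE ?subnn; [|lia..].
    by rewrite natrX -exprMn mulN1r natrB addn1 // ltnW.
  by move=> m j; apply: parking_coef_rec.
Qed.
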